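(* Let $(\Omega,\mathcal{F})$ be a measurable space and endow $[0,1]$ with the Euclidean topology. Suppose a procedure generates a set $\mathcal{P}\subseteq\Delta(\Omega,\mathcal{F})$ of probability measures and then selects one element $P^\star$ from $\mathrm{Conv}(\mathcal{P})$, so that the lower and upper probabilities after the procedure both equal $P^\star$. Fix $A\in\mathcal{F}$ and assume that $\mathcal{P}(A):=\{P(A):P\in\mathcal{P}\}$ is a Borel subset of $[0,1]$ and that $\#\mathcal{P}(A)\ge 2$. Then: (1) if $\mathcal{P}(A)$ is closed in the Euclidean topology and $P^\star(A)$ belongs to the boundary of $\mathcal{P}(A)$ in $[0,1]$, then the procedure weakly constricts $A$; (2) if instead $P^\star(A)$ belongs to the interior of $\mathcal{P}(A)$ in $[0,1]$, then the procedure strictly constricts $A$.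
   Context: $\Delta(\Omega,\mathcal{F})$ is the space of countably additive probability measures on $(\Omega,\mathcal{F})$; $\#$ denotes cardinality and $\mathrm{Conv}$ the convex hull. The lower and upper probabilities before selection are $\underline{P}(A)=\inf_{P\in\mathcal{P}}P(A)$ and $\overline{P}(A)=\sup_{P\in\mathcal{P}}P(A)$. A procedure with resulting lower and upper probabilities $\underline{P}'$ and $\overline{P}'$ strictly (uniformly) constricts $A\in\mathcal{F}$ if $\underline{P}'(A)>\underline{P}(A)$ and $\overline{P}'(A)<\overline{P}(A)$; it weakly constricts $A$ if one of these two inequalities is allowed to be weak. Here $\underline{P}'=\overline{P}'=P^\star$, so strict constriction of $A$ means $\underline{P}(A)<P^\star(A)<\overline{P}(A)$, and weak constriction means $\underline{P}(A)\le P^\star(A)\le\overline{P}(A)$ with at least one of the two inequalities strict.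
   Formalization: Part (2) additionally assumes 0 < P*(A) < 1: if P*(A) is 0 or 1 and lies in the interior of 𝒫(A) relative to [0,1], it equals the lower or upper probability, so strict constriction fails (e.g. 𝒫 all measures on {a,b}, A={a}, P*=δ_b). *)

(* Defs.v *)
From HB Require Import structures.
From mathcomp Require Import all_boot all_order all_algebra.
From mathcomp Require Import all_classical all_reals all_analysis.

Set Implicit Arguments.
Unset Strict Implicit.
Unset Printing Implicit Defensive.

Import Order.TTheory GRing.Theory Num.Theory.
Import numFieldNormedType.Exports.

Local Open Scope classical_set_scope.
Local Open Scope ring_scope.

(* Equality with the mixture is only required on measurable sets: a [probability]
   is a total function on [set T] whose values elsewhere carry no information. *)
Definition conv_hull d (T : measurableType d) (R : realType)
    (PP : set (probability T R)) : set (probability T R) :=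
  [set Q | exists (n : nat) (w : 'I_n -> R) (P : 'I_n -> probability T R),
    [/\ forall i, 0 <= w i,
        \sum_(i < n) w i = 1,
        forall i, PP (P i) &
        forall B, measurable B ->
          Q B = (\sum_(i < n) (w i)%:E * P i B)%E]].

(* The set written P(A): probabilities are finite, so [fine] loses nothing. *)
Definition prob_values d (T : measurableType d) (R : realType)
    (PP : set (probability T R)) (A : set T) : set R :=
  [set fine (P A) | P in PP].

Definition lower_prob d (T : measurableType d) (R : realType)
    (PP : set (probability T R)) (A : set T) : \bar R :=
  ereal_inf [set P A | P in PP].

Definition upper_prob d (T : measurableType d) (R : realType)
    (PP : set (probability T R)) (A : set T) : \bar R :=
  ereal_sup [set P A | P in PP].

(* [L'] and [U'] are the lower and upper probabilities after the procedure. *)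
Definition strictly_constricts d (T : measurableType d) (R : realType)
    (PP : set (probability T R)) (L' U' : set T -> \bar R) (A : set T) : Prop :=
  (lower_prob PP A < L' A)%E /\ (U' A < upper_prob PP A)%E.

Definition weakly_constricts d (T : measurableType d) (R : realType)
    (PP : set (probability T R)) (L' U' : set T -> \bar R) (A : set T) : Prop :=
  ((lower_prob PP A < L' A)%E /\ (U' A <= upper_prob PP A)%E) \/
  ((lower_prob PP A <= L' A)%E /\ (U' A < upper_prob PP A)%E).

Definition boundary (X : topologicalType) (S : set X) : set X :=
  closure S `\` interior S.

(* [0, 1] with the topology induced by R. Its carrier is R, the points outside
   [0, 1] being isolated; for subsets of [0, 1] the closure, interior and boundary
   are therefore those relative to [0, 1]. *)
Definition unit_interval (R : realType) : topologicalType :=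
  subspace (`[0, 1]%classic : set R).

(* Main.v *)
Require Import Defs.
From HB Require Import structures.
From mathcomp Require Import all_boot all_order all_algebra.
From mathcomp Require Import all_classical all_reals all_analysis.

Set Implicit Arguments.
Unset Strict Implicit.
Unset Printing Implicit Defensive.

Import Order.TTheory GRing.Theory Num.Theory.
Import numFieldNormedType.Exports.

Local Open Scope classical_set_scope.
Local Open Scope ring_scope.

(** A finite mixture of elements of [PP] gives [A] a weighted average of their values, so [Pstar A]
    lies between the lower and the upper probability ([conv_hull_ge], [conv_hull_le]). Two distinct
    values separate these bounds ([lower_prob_lt_upper_prob]), so [Pstar A] cannot equal both: this
    is weak constriction. For strict constriction, an interior value strictly between 0 and 1 has a
    ball of values of [PP] around it ([interior_unit_interval_ball]), hence attained values on
    either side. *)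

Lemma conv_hull_ge d (T : measurableType d) (R : realType)
    (PP : set (probability T R)) (Q : probability T R) (A : set T) (c : \bar R) :
  conv_hull PP Q -> measurable A ->
  (forall P, PP P -> (c <= P A)%E) -> (c <= Q A)%E.
Proof.
move=> [n [w [P [w0 w1 PPP QE]]]] mA cP.
(* Write [c] as the sum of the [w i * c], to compare termwise; as [c] may be infinite, distributing
   over the sum relies on nonnegative weights. *)
rewrite QE// -[leLHS]mul1e -[1%E]/(1%:E) -w1 -sumEFin ge0_sume_distrl; last first.
  by move=> i _; rewrite lee_fin.
by apply: lee_sum => i _; apply: lee_wpmul2l; [rewrite lee_fin|exact: cP].
Qed.

Lemma conv_hull_le d (T : measurableType d) (R : realType)
    (PP : set (probability T R)) (Q : probability T R) (A : set T) (c : \bar R) :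
  conv_hull PP Q -> measurable A ->
  (forall P, PP P -> (P A <= c)%E) -> (Q A <= c)%E.
Proof.
move=> [n [w [P [w0 w1 PPP QE]]]] mA cP.
rewrite QE// -[leRHS]mul1e -[1%E]/(1%:E) -w1 -sumEFin ge0_sume_distrl; last first.
  by move=> i _; rewrite lee_fin.
by apply: lee_sum => i _; apply: lee_wpmul2l; [rewrite lee_fin|exact: cP].
Qed.

Lemma card_ge2_distinct (T : pointedType) (S : set T) :
  (`I_2 #<= S)%card -> exists x y, [/\ S x, S y & x <> y].
Proof.
move=> /pcard_leP[f]; exists (f 0%N), (f 1%N); split; [exact: funS..|].
by move=> /(@inj _ _ _ f); rewrite !inE => /(_ isT isT).
Qed.

Lemma lower_prob_le_value d (T : measurableType d) (R : realType)
    (PP : set (probability T R)) (A : set T) (x : R) :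
  measurable A -> prob_values PP A x -> (lower_prob PP A <= x%:E)%E.
Proof.
move=> mA [P PPP <-]; rewrite fineK ?fin_num_measure//.
by apply: ereal_inf_lbound; exists P.
Qed.

Lemma value_le_upper_prob d (T : measurableType d) (R : realType)
    (PP : set (probability T R)) (A : set T) (x : R) :
  measurable A -> prob_values PP A x -> (x%:E <= upper_prob PP A)%E.
Proof.
move=> mA [P PPP <-]; rewrite fineK ?fin_num_measure//.
by apply: ereal_sup_ubound; exists P.
Qed.

Lemma lower_prob_lt_upper_prob d (T : measurableType d) (R : realType)
    (PP : set (probability T R)) (A : set T) :
  measurable A -> (`I_2 #<= prob_values PP A)%card ->
  (lower_prob PP A < upper_prob PP A)%E.
Proof.
move=> mA /card_ge2_distinct[x [y [Sx Sy /eqP]]].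
by rewrite neq_lt => /orP[] lt_xy; [move: Sx Sy|move: Sy Sx] => lo up;
  apply: le_lt_trans (lower_prob_le_value mA lo) _;
  apply: lt_le_trans (value_le_upper_prob mA up); rewrite lte_fin.
Qed.

(** Inside the open interval, neighbourhoods relative to [0, 1] are those of [R]. At 0 or 1 they may
    be one-sided: [0, 1] is its own relative interior but contains no ball around 0, and there the
    value 0 is not strictly above the lower bound. *)
Lemma interior_unit_interval_ball (R : realType) (S : set R) (p : R) :
  0 < p < 1 -> @interior (unit_interval R) S p ->
  exists2 e : R, 0 < e & ball p e `<=` S.
Proof.
move=> p01; rewrite /interior /unit_interval -nbhs_subspace_interior; last first.
  by rewrite interior_itv/= in_itv.
by move=> /nbhs_ballP[e e0 eS]; exists e.
Qed.

Theorem theorem11 (d : measure_display) (T : measurableType d) (R : realType)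
    (PP : set (probability T R)) (Pstar : probability T R)
    (hconv : conv_hull PP Pstar)
    (A : set T) (mA : measurable A)
    (hBorel : measurable (prob_values PP A))
    (hcard : (`I_2 #<= prob_values PP A)%card) :
  (@closed (unit_interval R) (prob_values PP A) ->
   @boundary (unit_interval R) (prob_values PP A) (fine (Pstar A)) ->
   weakly_constricts PP Pstar Pstar A)
  /\
  (@interior (unit_interval R) (prob_values PP A) (fine (Pstar A)) ->
   0 < fine (Pstar A) < 1 ->
   strictly_constricts PP Pstar Pstar A).
Proof.
have fPA : (fine (Pstar A))%:E = Pstar A by rewrite fineK ?fin_num_measure.
split=> [_ _|Sp p01].
  have lo : (lower_prob PP A <= Pstar A)%E.
    by apply: conv_hull_ge hconv mA _ => P PPP; apply: ereal_inf_lbound; exists P.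
  have up : (Pstar A <= upper_prob PP A)%E.
    by apply: conv_hull_le hconv mA _ => P PPP; apply: ereal_sup_ubound; exists P.
  (* If [Pstar A] does not exceed the lower probability, the gap between the two bounds makes the
     upper inequality strict. *)
  have [lt_lo|ge_lo] := ltP (lower_prob PP A) (Pstar A); first by left.
  right; split=> //.
  exact: le_lt_trans ge_lo (lower_prob_lt_upper_prob mA hcard).
have [e e0 eS] := interior_unit_interval_ball p01 Sp.
(* The ball is open, so half the radius is used: both points at distance [e / 2] from [Pstar A] are
   values of [PP] at [A]. *)
have e20 : 0 < e / 2 by rewrite divr_gt0.
have lt_e2 : e / 2 < e by rewrite ltr_pdivrMr// ltr_pMr// ltr1n.
split; rewrite -fPA.
  apply: (@le_lt_trans _ _ (fine (Pstar A) - e / 2)%:E).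
    apply: lower_prob_le_value => //; apply: eS.
    by rewrite /ball/= opprB addrCA subrr addr0 gtr0_norm.
  by rewrite lte_fin ltrBlDr ltrDl.
apply: (@lt_le_trans _ _ (fine (Pstar A) + e / 2)%:E).
  by rewrite lte_fin ltrDl.
apply: value_le_upper_prob => //; apply: eS.
by rewrite /ball/= opprD addrA subrr add0r normrN gtr0_norm.
Qed.
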